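(* If $\widehat\rho$ is a local minimiser of $\mathcal F$ on $\mathcal A_M$ with respect to the $L^1(\Omega)$ topology, then there exists $C\in\mathbb R$ such that $$U'(\widehat\rho(x))+V(x)\ge C\quad\text{for a.e. }x\text{ such that }0\le\widehat\rho(x)<\alpha,$$ $$U'(\widehat\rho(x))+V(x)\le C\quad\text{for a.e. }x\text{ such that }0<\widehat\rho(x)\le\alpha .$$ Furthermore, if $U'$ is invertible, then $$\widehat\rho(x)=T_{0,\alpha}\circ(U')^{-1}(C-V(x))\quad\text{for a.e. }x\in\Omega. \qquad( * )$$ Lastly, if $U''(s)>0$ for a.e. $s\in(0,\alpha)$ and $M\in(0,\alpha|\Omega|)$, there exists a unique $C$ such that the function given by $( * )$ has mass $M$.
   Context: Setting. $\Omega\subset\mathbb R^d$ is a bounded, connected, smooth domain. Standing assumptions: (1) $\alpha\in(0,\infty)$, $\mathrm m\in C([0,\alpha])\cap C^1((0,\alpha))$, $\mathrm m(0)=\mathrm m(\alpha)=0$, $\mathrm m>0$ on $(0,\alpha)$; (2) $V\in C^2(\overline\Omega)$, $V\ge0$; (3) $U\in W^{1,1}((0,\alpha))\cap C^3((0,\alpha))$, $U''\ge0$, and $s_0\in(0,\alpha)$ is a fixed point with $U''(s_0)>0$; (4) $\mathrm m U''\in L^1(0,\alpha)$ and, with $\Phi(s):=\int_{s_0}^s\mathrm m(\tau)U''(\tau)\,d\tau$, one has $\Phi(0)<\Phi(s)<\Phi(\alpha)$ for $s\in(0,\alpha)$ and $$\sup_{s\in[0,\alpha]}\left|\tfrac{(\Phi(\alpha)-\Phi(s))\Phi(s)}{\Phi'(s)}\right|+\left|\tfrac{(\Phi(s)-\Phi(0))\Phi(s)}{\Phi'(s)}\right|<\infty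 .$$ Notation: $\mathcal A=\{\rho\in L^1(\Omega):0\le\rho\le\alpha\}$; $\mathcal A_M=\{\rho\in\mathcal A:\|\rho\|_{L^1(\Omega)}=M\}$; $\mathcal F[\rho]=\int_\Omega U(\rho)\,dx+\int_\Omega V\rho\,dx$. The values $U'(0)$, $U'(\alpha)$ are understood as the (possibly infinite) limits $\underline\zeta:=U'(0^+)$ and $\overline\zeta:=U'(\alpha^-)$. The function $T_{0,\alpha}\circ(U')^{-1}:\mathbb R\to[0,\alpha]$ is defined by: value $\alpha$ if $\zeta\ge\overline\zeta$; value $(U')^{-1}(\zeta)$ if $\zeta\in(\underline\zeta,\overline\zeta)$; value $0$ if $\zeta\le\underline\zeta$.
   Formalization: The existence of C is stated except when M=0 and U'(0+)=-∞, or M=α|Ω| and U'(α-)=+∞; there the minimiser is constantly 0 (resp. α) and no real C can satisfy the inequalities, so the claim as stated is false. *)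

(* Defs.v *)
From HB Require Import structures.
From mathcomp Require Import all_boot all_order all_algebra.
From mathcomp Require Import all_classical all_reals all_analysis.
Set Implicit Arguments.
Unset Strict Implicit.
Unset Printing Implicit Defensive.
Import Order.TTheory GRing.Theory Num.Def Num.Theory.
Import numFieldNormedType.Exports.
Local Open Scope ring_scope.
Local Open Scope classical_set_scope.

(** 'rV[R]_n carries the sigma-algebra generated by the coordinates (the Borel
    sigma-algebra), exactly as the library does for tuples; the Lebesgue
    measure is the n-fold product of the one-dimensional one. *)

Definition measure_rV_display : measure_display -> measure_display.
Proof. exact. Qed.

Section measurable_rV.
Context {R : realType} (n : nat).

Definition coord_rV (i : 'I_n) (x : 'rV[R]_n) : measurableTypeR R := x ord0 i.

Let rV_set0 : g_sigma_preimage coord_rV set0.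
Proof. exact: sigma_algebra0. Qed.

Let rV_setC A : g_sigma_preimage coord_rV A -> g_sigma_preimage coord_rV (~` A).
Proof. exact: sigma_algebraC. Qed.

Let rV_bigcup (F : (set 'rV[R]_n)^nat) :
  (forall i, g_sigma_preimage coord_rV (F i)) ->
  g_sigma_preimage coord_rV (\bigcup_i (F i)).
Proof. exact: sigma_algebra_bigcup. Qed.

HB.instance Definition _ := @isMeasurable.Build
  (measure_rV_display default_measure_display) 'rV[R]_n
  (g_sigma_preimage coord_rV) rV_set0 rV_setC rV_bigcup.

End measurable_rV.

Definition cons_rV {R : realType} n (p : R * 'rV[R]_n) : 'rV[R]_n.+1 :=
  \row_(i < n.+1) oapp (p.2 ord0) p.1 (unlift ord0 i).

Section cons_rV_theory.
Context {R : realType}.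

Lemma measurable_coord_rV n (i : 'I_n) :
  measurable_fun [set: 'rV[R]_n] (coord_rV i).
Proof.
move=> _ Y mY; rewrite setTI; apply: sub_sigma_algebra => /=.
rewrite -bigcup_seq/=; exists i => /=; first by rewrite mem_index_enum.
by exists Y => //; rewrite setTI.
Qed.

Lemma measurable_fun_rV d (T : measurableType d) n (f : T -> 'rV[R]_n) :
  (forall i, measurable_fun [set: T] (coord_rV i \o f)) ->
  measurable_fun [set: T] f.
Proof.
move=> mf _ A mA; rewrite setTI.
have : (image_set_system setT f measurable) A; last first.
  by rewrite /image_set_system/= setTI.
have : g_sigma_preimage (@coord_rV R n) A by [].
apply: smallest_sub.
  by apply: sigma_algebra_image; exact: sigma_algebra_measurable.
rewrite -bigcup_seq => B [i _ [Y mY <-]].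
rewrite /image_set_system/= !setTI -comp_preimage -[X in measurable X]setTI.
exact: mf.
Qed.

Lemma measurable_cons_rV n :
  measurable_fun [set: R * 'rV[R]_n] (@cons_rV R n).
Proof.
apply: measurable_fun_rV => i.
case: (unliftP ord0 i) => [j|] ->.
  rewrite (_ : _ \o _ = coord_rV j \o snd).
    by apply: measurableT_comp => //; exact: measurable_coord_rV.
  by apply/funext => p; rewrite /= /coord_rV /cons_rV !mxE liftK.
rewrite (_ : _ \o _ = fst)//.
by apply/funext => p; rewrite /= /coord_rV /cons_rV !mxE unlift_none.
Qed.

Definition uncons_rV n (x : 'rV[R]_n.+1) : R * 'rV[R]_n :=
  (x ord0 ord0, \row_j x ord0 (lift ord0 j)).

Lemma uncons_rVK n : cancel (@uncons_rV n) (@cons_rV R n).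
Proof.
by move=> x; apply/rowP => i; rewrite mxE; case: unliftP => [j|] -> //=;
  rewrite mxE.
Qed.

Lemma cons_rVK n : cancel (@cons_rV R n) (@uncons_rV n).
Proof.
move=> [a u]; congr pair; first by rewrite mxE unlift_none.
by apply/rowP => j; rewrite !mxE liftK.
Qed.

Lemma measurable_uncons_rV n :
  measurable_fun [set: 'rV[R]_n.+1] (@uncons_rV n).
Proof.
apply/measurable_fun_pairP; split; first exact: (measurable_coord_rV ord0).
apply: measurable_fun_rV => i.
rewrite (_ : _ \o _ = coord_rV (lift ord0 i)); first exact: measurable_coord_rV.
by apply/funext => x; rewrite /= /coord_rV mxE.
Qed.

End cons_rV_theory.

Section cons_measure.
Context {R : realType} (n : nat).
Variable mu : {sigma_finite_measure set 'rV[R]_n -> \bar R}.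

Definition cons_measure : set 'rV[R]_n.+1 -> \bar R :=
  pushforward (@lebesgue_measure R \x mu)%E (@cons_rV R n).

Let cons_measure0 : cons_measure set0 = 0%E.
Proof. by rewrite /cons_measure /pushforward preimage_set0 measure0. Qed.

Let cons_measure_ge0 A : (0 <= cons_measure A)%E.
Proof. by rewrite /cons_measure /pushforward measure_ge0. Qed.

Let cons_measure_sigma_additive : semi_sigma_additive cons_measure.
Proof.
move=> F mF tF mUF; rewrite /cons_measure /pushforward preimage_bigcup.
apply: measure_semi_sigma_additive.
- by move=> k; rewrite -[X in measurable X]setTI; exact: measurable_cons_rV.
- apply/trivIsetP => /= i j _ _ ij; rewrite -preimage_setI.
  by move/trivIsetP : tF => /(_ _ _ _ _ ij) ->//; rewrite preimage_set0.
- rewrite -preimage_bigcup -[X in measurable X]setTI.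
  exact: measurable_cons_rV.
Qed.

HB.instance Definition _ := isMeasure.Build _ _ _ cons_measure
  cons_measure0 cons_measure_ge0 cons_measure_sigma_additive.

Let cons_measure_sigma_finite : sigma_finite setT cons_measure.
Proof.
have /sigma_finiteP[F [TF ndF Foo]] := sigma_finiteT (@lebesgue_measure R).
have /sigma_finiteP[G [TG ndG Goo]] := sigma_finiteT mu.
exists (fun k => @uncons_rV R n @^-1` (F k `*` G k)).
  rewrite -preimage_bigcup (_ : \bigcup_k _ = setT) ?preimage_setT//.
  apply/seteqP; split=> // -[t x] _.
  have [i _ Fit] : (\bigcup_i F i) t by rewrite -TF.
  have [j _ Gjx] : (\bigcup_j G j) x by rewrite -TG.
  exists (maxn i j) => //; split => /=.
    by move: t Fit; exact/subsetPset/ndF/leq_maxl.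
  by move: x Gjx; exact/subsetPset/ndG/leq_maxr.
move=> k; have [mF Fk] := Foo k; have [mG Gk] := Goo k; split.
  rewrite -[X in measurable X]setTI; apply: measurable_uncons_rV => //.
  exact: measurableX.
rewrite /cons_measure /pushforward -comp_preimage.
rewrite (_ : _ \o _ = id) ?preimage_id; last first.
  by apply/funext => p; exact: cons_rVK.
by rewrite product_measure1E// lte_mul_pinfty// ge0_fin_numE.
Qed.

HB.instance Definition _ := Measure_isSigmaFinite.Build _ _ _ cons_measure
  cons_measure_sigma_finite.

End cons_measure.

Fixpoint lebesgue_rV {R : realType} n :
    {sigma_finite_measure set 'rV[R]_n -> \bar R} :=
  match n with
  | 0 => dirac (0 : 'rV[R]_0)
  | n'.+1 => cons_measure (lebesgue_rV n')
  end.

Lemma lebesgue_rV_prod {R : realType} n (A : 'I_n -> set R) :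
  (forall i, measurable (A i)) ->
  lebesgue_rV n [set x : 'rV[R]_n | forall i, A i (x ord0 i)] =
  (\prod_(i < n) lebesgue_measure (A i))%E.
Proof.
elim: n A => [|n IH] A mA.
  rewrite big_ord0 /= (_ : [set _ | _] = setT) ?diracT//.
  by apply/seteqP; split=> // x _ [].
rewrite big_ord_recl -IH//= /cons_measure /pushforward.
rewrite -product_measure1E//; last first.
  pose B := \bigcap_(i in [set: 'I_n]) (coord_rV i @^-1` A (lift ord0 i)).
  rewrite (_ : [set _ | _] = B); last first.
    by apply/seteqP; split=> x /= h i; [move=> _; exact: h|exact: h].
  apply: fin_bigcap_measurable => // i _.
  by rewrite -[X in measurable X]setTI; apply: measurable_coord_rV => //; exact: mA.
  exact: mA.
congr (_ _); apply/seteqP; split => -[t x] /=.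
- move=> h; split => [|i]; first by have := h ord0; rewrite mxE unlift_none.
  by have := h (lift ord0 i); rewrite mxE liftK.
- move=> [At Ax] i; rewrite mxE.
  by case: unliftP => [j|] -> /=; [exact: Ax|].
Qed.

Section Ck.
Context {R : realType}.

(* C^k(A), for A open. *)
Definition Ck_line (k : nat) (A : set R) (f : R -> R) : Prop :=
  (forall j s, (j < k)%N -> A s -> derivable (derive1n j f) s 1) /\
  (forall j s, (j <= k)%N -> A s -> {for s, continuous (derive1n j f)}).

(* pderiv [:: i1; ..; ik] f is the iterated partial derivative
   d_{i1} (d_{i2} (.. (d_{ik} f))) *)
Fixpoint pderiv n (l : seq 'I_n) (f : 'rV[R]_n -> R) : 'rV[R]_n -> R :=
  if l is i :: l' then 'D_(delta_mx ord0 i) (pderiv l' f) else f.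

(* C^k(A), for A open: all iterated partial derivatives up to order k exist and
   are continuous. *)
Definition Ck n (k : nat) (A : set 'rV[R]_n) (f : 'rV[R]_n -> R) : Prop :=
  (forall (l : seq 'I_n) i x, (size l < k)%N -> A x ->
     derivable (pderiv l f) x (delta_mx ord0 i)) /\
  (forall (l : seq 'I_n) x, (size l <= k)%N -> A x ->
     {for x, continuous (pderiv l f)}).

(* C^k(closure A) for an open set A of R^n: f is C^k in A and all its partial
   derivatives up to order k extend continuously to the closure of A, f itself
   being its own extension. *)
Definition Ck_closure n (k : nat) (A : set 'rV[R]_n) (f : 'rV[R]_n -> R) :
    Prop :=
  [/\ Ck k A f, {within closure A, continuous f} &
   forall l : seq 'I_n, (size l <= k)%N ->
     exists2 g : 'rV[R]_n -> R, {within closure A, continuous g} &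
       {in A, pderiv l f =1 g}].

(* The boundary of Omega is locally the graph of a C^infinity function of all
   coordinates but the i-th, with Omega lying strictly on one side of it (above
   if b = false, below if b = true). *)
Definition smooth_boundary d (Omega : set 'rV[R]_d) : Prop :=
  forall p, (closure Omega `\` interior Omega) p ->
    exists (r : R) (i : 'I_d) (b : bool) (gamma : 'rV[R]_d.-1 -> R),
      [/\ 0 < r, (forall k, Ck k setT gamma) &
       forall x, ball p r x ->
         Omega x <-> 0 < (-1) ^+ b * (x ord0 i - gamma (col' i x))].

Definition bounded_smooth_domain d (Omega : set 'rV[R]_d) : Prop :=
  [/\ open Omega, Omega !=set0, connected Omega, bounded_set Omega &
   smooth_boundary Omega].

End Ck.

Section line.
Context {R : realType}.

Definition L1_on (A : set R) (f : R -> R) : Prop :=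
  lebesgue_measure.-integrable A (EFin \o f).

(* phi belongs to C_c^infinity(A) *)
Definition test_function (A : set R) (phi : R -> R) : Prop :=
  [/\ (forall k, Ck_line k setT phi),
      compact (closure [set s | phi s != 0]) &
      closure [set s | phi s != 0] `<=` A].

(* g is the weak derivative of f. *)
Definition W11 (A : set R) (f : R -> R) : Prop :=
  L1_on A f /\
  exists2 g : R -> R, L1_on A g &
    forall phi, test_function A phi ->
      \int[lebesgue_measure]_(s in A) (f s * derive1 phi s) =
      - \int[lebesgue_measure]_(s in A) (g s * phi s).

Definition oriented_integral (f : R -> R) (a b : R) : R :=
  if a <= b then \int[lebesgue_measure]_(t in `]a, b[) f t
  else - \int[lebesgue_measure]_(t in `]b, a[) f t.

Definition Phi (m U : R -> R) (s0 s : R) : R :=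
  oriented_integral (fun t => m t * derive1n 2 U t) s0 s.

(* The one-sided limits U'(0+) and U'(alpha-); they exist in the extended reals
   when U' is monotone. *)
Definition zeta_lo (U : R -> R) : \bar R :=
  lim ((derive1 U t)%:E @[t --> 0^'+]).

Definition zeta_hi (U : R -> R) (alpha : R) : \bar R :=
  lim ((derive1 U t)%:E @[t --> alpha^'-]).

(* U' on [0, alpha], with its possibly infinite values at the end points. *)
Definition dU (U : R -> R) (alpha s : R) : \bar R :=
  if s <= 0 then zeta_lo U
  else if alpha <= s then zeta_hi U alpha
  else (derive1 U s)%:E.

(* T_{0,alpha} o (U')^{-1}; 'pinv_(fun=> 0) A f is the inverse of f restricted
   to A. *)
Definition T_dU_inv (U : R -> R) (alpha zeta : R) : R :=
  if (zeta_hi U alpha <= zeta%:E)%E then alpha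
  else if (zeta%:E <= zeta_lo U)%E then 0
  else 'pinv_(fun=> 0) `]0, alpha[ (derive1 U) zeta.

End line.

Section energy.
Context {R : realType} (d : nat).
Implicit Types (Omega : set 'rV[R]_d) (rho V : 'rV[R]_d -> R).

Definition L1norm Omega rho : R := \int[lebesgue_rV d]_(x in Omega) `|rho x|.

Definition volume Omega : R := fine (lebesgue_rV d Omega).

(* Elements of L^1(Omega) are represented by functions, up to a.e. equality; only
   the values on Omega matter. *)
Definition calA Omega (alpha : R) : set ('rV[R]_d -> R) :=
  [set rho | (lebesgue_rV d).-integrable Omega (EFin \o rho) /\
    {ae lebesgue_rV d, forall x, Omega x -> 0 <= rho x <= alpha}].

Definition calA_mass Omega (alpha M : R) : set ('rV[R]_d -> R) :=
  [set rho | calA Omega alpha rho /\ L1norm Omega rho = M].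

Definition energy (U : R -> R) V Omega rho : R :=
  \int[lebesgue_rV d]_(x in Omega) U (rho x) +
  \int[lebesgue_rV d]_(x in Omega) (V x * rho x).

Definition L1_local_minimiser Omega (F : ('rV[R]_d -> R) -> R)
    (A : set ('rV[R]_d -> R)) rho : Prop :=
  A rho /\
  exists2 e : R, 0 < e &
    forall rho', A rho' -> L1norm Omega (rho' \- rho) < e -> F rho <= F rho'.

End energy.

(* Main.v *)
Require Import Defs.
From mathcomp Require Import all_boot all_order all_algebra.
From mathcomp Require Import all_classical all_reals all_analysis.
From mathcomp Require Import measurable_realfun lra.
Set Implicit Arguments.
Unset Strict Implicit.
Unset Printing Implicit Defensive.
Import Order.TTheory GRing.Theory Num.Def Num.Theory.
Import numFieldNormedType.Exports.
Local Open Scope ring_scope.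
Local Open Scope classical_set_scope.

(** Local minimality is tested against the transfer of a small amount of mass
    from a set B on which the potential U'(rho) + V is large to a set A on which
    it is small.  U being convex, a move of rho from r to r + h costs at most
    h * U'(q) as soon as r + h <= q; if rho <= p < q on A, rho >= p' > q' on B,
    U'(q) + V <= c on A and U'(q') + V >= c' on B with c < c', moving the mass
    dl from B to A changes the energy by at most dl * (c - c') < 0.  Hence A or B
    is negligible (mass_exchange).  Only finite increments of U enter, because
    U' may be infinite at 0 and alpha and the integral of U'(rho) may diverge.
    Rational p and q exhaust the set where rho < alpha and the potential
    is below c, and similarly for B: so for all c < c', either c is an a.e. lower
    bound of the potential where rho < alpha, or c' is an a.e. upper bound of it
    where rho > 0 (lower_or_upper).  The constant C is the supremum of the lower
    bounds.  That set is empty only if rho = 0 a.e., and is unbounded only if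
    rho = alpha a.e.; then the end-point values of U', finite in these cases,
    give a constant directly (pot_threshold).  The formula for rho is read off
    the two inequalities (pot_minimiser_formula).

    For the last claim, write T for T_{0,alpha} o (U')^{-1}.  When U' is
    injective, T z < s iff z < U'(s) for every s in (0, alpha), and likewise with
    the reversed order (T_dU_inv_ltE, T_dU_inv_gtE); monotonicity and continuity
    of T follow at once.  So the mass of T(C - V) is continuous in C, it is small
    for C very negative and close to alpha |Omega| for C large, because V is
    bounded: every M in between is attained.  If two levels C1 < C2 gave the same
    mass, then T(C1 - V) = T(C2 - V) a.e., hence, by continuity, everywhere on
    Omega.  As T is strictly increasing where its values lie in (0, alpha),
    T(C1 - V) would take its values in {0, alpha}, and would be constant since
    Omega is connected: its mass would be 0 or alpha |Omega|. *)

(** * Lebesgue measure and topology of the space of row vectors *)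

Section rV_topology_measure.
Context {R : realType}.

Lemma box_measurable n (B : 'I_n -> set R) : (forall i, measurable (B i)) ->
  measurable [set x : 'rV[R]_n | forall i, B i (x ord0 i)].
Proof.
move=> mB.
rewrite (_ : [set _ | _] = \bigcap_(i in [set: 'I_n]) (coord_rV i @^-1` B i)).
  apply: fin_bigcap_measurable => // i _.
  by rewrite -[X in measurable X]setTI; apply: measurable_coord_rV => //; exact: mB.
by apply/seteqP; split=> x /= h i; [move=> _; exact: h|exact: h].
Qed.

Lemma ball_rV n (x : 'rV[R]_n) e : 0 < e ->
  ball x e = [set y | forall i, ball (x ord0 i) e (y ord0 i)].
Proof.
move=> e0; apply/seteqP; split => [y [_ h] i|y h]; first exact: h.
by split=> // i j; rewrite (ord1 i).
Qed.

Lemma ball_rV_measurable n (x : 'rV[R]_n) e : 0 < e -> measurable (ball x e).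
Proof.
move=> e0; rewrite ball_rV//.
apply: (@box_measurable n (fun i => ball (x ord0 i) e)) => i.
exact: measurable_ball.
Qed.

(** The sigma-algebra of 'rV[R]_n is generated by the coordinates.  An open set is
    the union of the balls contained in it that have a rational center and radius
    1 / (k + 1), and these are countably many. *)
Lemma open_rV_measurable n (A : set 'rV[R]_n) : open A -> measurable A.
Proof.
move=> oA.
pose c (p : 'rV[rat]_n * nat) : 'rV[R]_n := map_mx ratr p.1.
pose B p := ball (c p) (p.2.+1%:R^-1 : R).
pose F p := if pselect (B p `<=` A) then B p else set0.
have -> : A = \bigcup_p F p.
  apply/seteqP; split => [x Ax|x [p _]]; last first.
    by rewrite /F; case: pselect => // h; exact: h.
  have /nbhs_ballP[e /= e0 eA] : nbhs x A by exact: open_nbhs_nbhs.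
  (* B (q, k) contains x and stays in ball x e: two radii add up to less than e *)
  have [k ke] : exists k : nat, k.+1%:R^-1 < e / 2.
    have /= [k _ /(_ _ (leqnn _))] : \forall k \near \oo, k.+1%:R^-1 < e / 2.
      near=> k; near: k.
      exact: (near_infty_natSinv_lt (PosNum (divr_gt0 e0 (ltr0n _ 2)))).
    by exists k.
  have k0 : 0 < k.+1%:R^-1 :> R by rewrite invr_gt0.
  have /choice[q qP] : forall i, exists q : rat,
      `|x ord0 i - ratr q| < k.+1%:R^-1.
    move=> i; move: (k.+1%:R^-1 : R) k0 => r r0.
    have /rat_in_itvoo[q] : x ord0 i - r < x ord0 i + r by lra.
    rewrite in_itv/= => /andP[? ?]; exists q.
    by rewrite ltr_norml; apply/andP; split; lra.
  pose p : 'rV[rat]_n * nat := (\row_i q i, k).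
  exists p => //; rewrite /F; case: pselect => [pA|[]] /=.
    rewrite /B ball_rV// => i; rewrite /c/= !mxE.
    by rewrite /ball/= distrC; exact: qP.
  rewrite /B ball_rV// => y /= yB; apply: eA; rewrite ball_rV// => i.
  have := yB i; have := qP i; rewrite /ball/= !mxE => h1 h2.
  rewrite (_ : _ - _ =
    (x ord0 i - ratr (q i)) + (ratr (q i) - y ord0 i)); last by lra.
  apply: (le_lt_trans (ler_normD _ _)).
  by move: (k.+1%:R^-1 : R) h1 h2 ke => r *; lra.
apply: countable_bigcupT_measurable => [|p]; first exact: countableP.
rewrite /F; case: pselect => /= h //.
by apply: (ball_rV_measurable (c p)); rewrite invr_gt0.
Unshelve. all: by end_near. Qed.

Lemma continuous_open_measurable n (A : set 'rV[R]_n) (f : 'rV[R]_n -> R) :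
  open A -> {in A, continuous f} -> measurable_fun A f.
Proof.
move=> oA cf; apply: (measurability _ (RGenOpens.measurableE R)).
move=> _ [_ [a [b ->] <-]].
apply: open_rV_measurable; rewrite openE => x [Ax fx].
apply: filterI; first exact: open_nbhs_nbhs.
apply: (cf x (mem_set Ax)); apply: open_nbhs_nbhs; split=> //.
Qed.

Lemma bounded_lebesgue_lty n (A : set 'rV[R]_n) :
  measurable A -> bounded_set A -> (lebesgue_rV n A < +oo)%E.
Proof.
move=> mA /pinfty_ex_gt0[M M0 AM].
pose B (i : 'I_n) := `[- M, M]%classic : set R.
have mB i : measurable (B i) by exact: measurable_itv.
apply: (@le_lt_trans _ _ (lebesgue_rV n [set x | forall i, B i (x ord0 i)])).
  apply: le_measure; rewrite ?inE//; first exact: box_measurable.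
  move=> x Ax i; rewrite /B/= in_itv/= -ler_norml.
  apply: le_trans (AM _ Ax); rewrite /normr/= mx_normrE.
  by apply: le_trans (le_bigmax _ _ (ord0, i)).
rewrite lebesgue_rV_prod//.
under eq_bigr do rewrite lebesgue_measure_itv/= lte_fin gtrN// -EFinB.
by rewrite prodEFin ltry.
Qed.

Lemma open_lebesgue_gt0 n (A : set 'rV[R]_n) :
  open A -> A !=set0 -> (0 < lebesgue_rV n A)%E.
Proof.
move=> oA [x Ax].
have /nbhs_ballP[e /= e0 eA] : nbhs x A by exact: open_nbhs_nbhs.
apply: (@lt_le_trans _ _ (lebesgue_rV n (ball x e))); last first.
  apply: le_measure; rewrite ?inE//; first exact: ball_rV_measurable.
  exact: open_rV_measurable.
rewrite ball_rV// (@lebesgue_rV_prod R n (fun i => ball (x ord0 i) e)); last first.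
  by move=> i; exact: measurable_ball.
under eq_bigr do rewrite lebesgue_measure_ball ?ltW//.
by rewrite prodEFin lte_fin prodr_gt0// => i _; rewrite mulrn_wgt0.
Qed.

End rV_topology_measure.

Lemma bounded_closure (R : realType) n (A : set 'rV[R]_n) :
  bounded_set A -> bounded_set (closure A).
Proof.
move=> /pinfty_ex_gt0[M M0 AM]; exists M; split; first exact: num_real.
move=> y My x clx; apply: le_trans (ltW My).
have cM : closed [set z : 'rV[R]_n | `|z| <= M].
  apply: (@closed_comp _ _ (@normr _ 'rV[R]_n) [set r | r <= M]);
    last exact: closed_le.
  by move=> z _; exact: norm_continuous.
have /(_ x clx) := closure_subset AM.
by rewrite -(iffLR (closure_id _) cM).
Qed.

Lemma continuous_closure_bounded (R : realType) n (A : set 'rV[R]_n)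
    (f : 'rV[R]_n -> R) : bounded_set A -> {within closure A, continuous f} ->
  exists K, forall x, A x -> `|f x| <= K.
Proof.
move=> /bounded_closure bA cf.
have cA : compact (closure A).
  by apply: bounded_closed_compact => //; exact: closed_closure.
have /(@compact_bounded _ R^o)/pinfty_ex_gt0[K K0 fK] := continuous_compact cf cA.
exists K => x Ax; apply: fK; exists x => //; exact: subset_closure.
Qed.

(** * Almost everywhere statements and integrals of bounded functions *)

Section ae_integral.
Context d (T : measurableType d) (R : realType)
  (mu : {measure set T -> \bar R}).
Import HBNNSimple.
Local Open Scope ereal_scope.

(** The integral of a nonnegative function, measurable or not, is a supremum over
    simple functions, and a simple function below f becomes a
    simple function below g, of the same integral, once it is set to 0 on the
    exceptional null set. *)
Lemma ge0_ae_le_integralT (f g : T -> \bar R) :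
  (forall x, 0 <= f x) -> (forall x, 0 <= g x) ->
  {ae mu, forall x, f x <= g x} -> \int[mu]_x f x <= \int[mu]_x g x.
Proof.
move=> f0 g0 [N [mN N0 fgN]]; rewrite !ge0_integralTE//.
apply: ge_ereal_sup => _ [h hf <-].
have mCN : measurable (~` N) by exact: measurableC.
have -> : sintegral mu h = sintegral mu (proj_nnsfun h mCN).
  rewrite -integralT_nnsfun (ge0_negligible_integral mN)//.
  - by rewrite setTD integral_nnsfun// mrestrict.
  - exact/measurable_EFinP.
  - by move=> x _; rewrite lee_fin.
apply: ereal_sup_ubound; exists (proj_nnsfun h mCN) => // x.
rewrite -mrestrict patchE; case: ifPn => // /set_mem Nx.
apply: le_trans (hf x) _; apply: contrapT => fg; apply: Nx; exact: fgN.
Qed.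

(** This is for U o rho, which may fail to be measurable: U is arbitrary outside
    [0, alpha], and rho may leave [0, alpha] on a null set. *)
Lemma ae_eq_Rintegral (D : set T) (f g : T -> R) :
  {ae mu, forall x, D x -> f x = g x} ->
  (\int[mu]_(x in D) f x = \int[mu]_(x in D) g x)%R.
Proof.
move=> fg; congr fine; rewrite integral_mkcond [RHS]integral_mkcond.
have le_int (u v : T -> R) : {ae mu, forall x, D x -> u x = v x} ->
  (\int[mu]_x ((EFin \o u) \_ D)^\+ x <= \int[mu]_x ((EFin \o v) \_ D)^\+ x) /\
  (\int[mu]_x ((EFin \o u) \_ D)^\- x <= \int[mu]_x ((EFin \o v) \_ D)^\- x).
  move=> uv; split; apply: ge0_ae_le_integralT => //;
    apply: filterS uv => x uv; rewrite ?funeposE ?funenegE !patchE;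
    by case: ifPn => // /set_mem/uv /= ->.
have gf : {ae mu, forall x, D x -> g x = f x}.
  by apply: filterS fg => x h /h.
have [fg1 fg2] := le_int _ _ fg; have [gf1 gf2] := le_int _ _ gf.
rewrite integralE [RHS]integralE; congr (_ - _); apply/eqP; rewrite eq_le.
  by rewrite fg1 gf1.
by rewrite fg2 gf2.
Qed.

Lemma ae_notin_null (A : set T) : measurable A -> mu A = 0 ->
  {ae mu, forall x, ~ A x}.
Proof. by move=> mA A0; exists A; split=> // x /=; exact: contrapT. Qed.

Lemma ae_forall_countable (J : countType) (P : J -> T -> Prop) :
  (forall j, {ae mu, forall x, P j x}) -> {ae mu, forall x j, P j x}.
Proof.
move=> h.
have : {ae mu, forall x (n : nat),
    if unpickle n is Some j then P j x else True}.
  apply: ae_foralln => n; case: (unpickle n) => [j|]; first exact: h.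
  exact: aeW.
by apply: filterS => x hx j; have := hx (pickle j); rewrite pickleK.
Qed.

End ae_integral.

Section bounded_functions.
Context d (T : measurableType d) (R : realType) (mu : {measure set T -> \bar R})
  (Omega : set T).
Hypotheses (mO : measurable Omega) (Ofin : (mu Omega < +oo)%E).

Lemma bounded_integrable (f : T -> R) (K : R) : measurable_fun Omega f ->
  (forall x, Omega x -> `|f x| <= K) -> mu.-integrable Omega (EFin \o f).
Proof.
move=> mf fK; apply: measurable_bounded_integrable => //.
exists K; split; first exact: num_real.
by move=> y Ky x Ox; apply: le_trans (fK _ Ox) (ltW Ky).
Qed.

Lemma Rintegral_indicZ (A : set T) (h : R) : measurable A -> A `<=` Omega ->
  \int[mu]_(x in Omega) (h * \1_A x) = h * fine (mu A).
Proof.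
move=> mA AO; rewrite RintegralZl//.
  by rewrite /Rintegral integral_indic// setIidl.
apply: (@bounded_integrable _ 1); first exact: measurable_indic.
by move=> x _; rewrite indicE; case: (_ \in _); rewrite ?normr1 ?normr0.
Qed.

Lemma measurable_comp_segment (a b : R) (U : R -> R) (f : T -> R) :
  {within `[a, b], continuous U} -> measurable_fun Omega f ->
  (forall x, Omega x -> a <= f x <= b) -> measurable_fun Omega (U \o f).
Proof.
move=> cU mf fab; apply: (@measurable_comp _ _ _ _ _ _ `[a, b]%classic) => //.
  by move=> _ [x Ox <-]; rewrite /= in_itv/=; exact: fab.
by apply: subspace_continuous_measurable_fun.
Qed.

End bounded_functions.

Lemma continuous_segment_bounded (R : realType) (a b : R) (U : R -> R) :
  a <= b -> {within `[a, b], continuous U} ->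
  exists K, forall s, a <= s <= b -> `|U s| <= K.
Proof.
move=> ab cU.
have [c _ cmax] := EVT_max ab cU; have [e _ emin] := EVT_min ab cU.
exists (`|U c| + `|U e|) => s sab.
have {}sab : s \in `[a, b]%R by rewrite in_itv.
have := cmax _ sab; have := emin _ sab.
have := ler_norm (U c); have := ler_norm (- U e); have := normr_ge0 (U c).
have := normr_ge0 (U e); rewrite normrN ler_norml => *.
by apply/andP; split; lra.
Qed.

Lemma nondecreasing_flat (R : realType) (a b : R) (f : R -> R) : a < b ->
  {in `[a, b]%R &, {homo f : x y / x <= y}} -> f a = f b ->
  forall s, a < s < b -> derive1 f s = 0.
Proof.
move=> ab f_le fab s sab; have cst : \forall t \near s, f t = f a.
  have sI : s \in `]a, b[%R by rewrite in_itv.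
  apply: filterS (near_in_itvoo sI) => t; rewrite in_itv/= => tI.
  by apply/eqP; rewrite eq_le {1}fab !f_le ?in_itv//=; lra.
by rewrite derive1E (near_eq_derive _ cst) derive_cst.
Qed.

(** If f x = f y, the monotone f is constant on [x, y], where its derivative then
    vanishes, although an interval is not a null set. *)
Lemma ae_pos_derivative_inj (R : realType) (a b : R) (f : R -> R) :
  {in `]a, b[%R &, {homo f : x y / x <= y}} ->
  {ae lebesgue_measure, forall s : R, a < s < b -> 0 < derive1 f s} ->
  {in `]a, b[%R &, injective f}.
Proof.
move=> f_le [N [mN N0 fN]].
have nflat x y : a < x -> x < y -> y < b -> f x <> f y.
  move=> ax xy yb fxy.
  have : (lebesgue_measure `]x, y[%classic <= @lebesgue_measure R N)%E.
    apply: le_measure; rewrite ?inE// => s; rewrite /= in_itv/= => sxy.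
    apply: fN => /= h.
    have sI : a < s < b by lra.
    suff fs0 : derive1 f s = 0 by have := h sI; rewrite fs0 ltxx.
    apply: (nondecreasing_flat xy) => // u v; rewrite !in_itv/= => uI vI uv.
    by apply: f_le; rewrite ?in_itv/=; lra.
  rewrite N0 lebesgue_measure_itv/= lte_fin xy -EFinB lee_fin; lra.
move=> x y; rewrite !in_itv/= => xI yI fxy.
have [xy|yx|//] := ltgtP x y.
  by exfalso; apply: (nflat x y) => //; lra.
by exfalso; apply: (nflat y x) => //; lra.
Qed.

(** * The slope of a convex function on [0, alpha] and its inverse *)

Section extended_slope.
Context {R : realType} (alpha : R) (U : R -> R).
Local Notation D := (derive1 U).
Local Notation I := `]0, alpha[%R.
Hypothesis alpha_gt0 : 0 < alpha.
Hypothesis D_le : {in I &, {homo D : x y / x <= y}}.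

(** U' is nondecreasing, so its limit at 0+ is its infimum.  Everything about the
    end-point values of U' goes through this description and its counterpart. *)
Lemma zeta_loE : zeta_lo U = ereal_inf [set (D t)%:E | t in [set` I]].
Proof.
apply: cvg_lim => //.
apply: (@nondecreasing_at_right_cvge _ (EFin \o D) 0 (BLeft alpha)).
  by rewrite bnd_simp.
by move=> x y xI yI xy; rewrite /= lee_fin; exact: D_le.
Qed.

Lemma zeta_hiE : zeta_hi U alpha = ereal_sup [set (D t)%:E | t in [set` I]].
Proof.
apply: cvg_lim => //.
rewrite -(opprK alpha); apply/cvg_at_leftNP; rewrite opprK.
have -> : [set (D t)%:E | t in [set` I]] =
    (EFin \o D \o -%R) @` [set` `]- alpha, 0[%R].
  apply/seteqP; split=> _ [t tI <-]; (exists (- t); last by rewrite /= ?opprK);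
    by move: tI; rewrite /= !in_itv/= => ?; lra.
apply: (@nonincreasing_at_right_cvge _ (EFin \o D \o -%R) (- alpha) (BLeft 0)).
  by rewrite bnd_simp oppr_lt0.
move=> x y; rewrite !in_itv/= => xI yI xy; rewrite lee_fin.
by apply: D_le; rewrite ?in_itv/=; lra.
Qed.

Lemma zeta_lo_le t : 0 < t < alpha -> (zeta_lo U <= (D t)%:E)%E.
Proof. by move=> tI; rewrite zeta_loE; apply: ereal_inf_lbound; exists t. Qed.

Lemma zeta_hi_ge t : 0 < t < alpha -> ((D t)%:E <= zeta_hi U alpha)%E.
Proof. by move=> tI; rewrite zeta_hiE; apply: ereal_sup_ubound; exists t. Qed.

Lemma zeta_lo_lt (c : \bar R) : (zeta_lo U < c)%E ->
  exists2 t, 0 < t < alpha & ((D t)%:E < c)%E.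
Proof. by rewrite zeta_loE => /ereal_inf_lt[_ [t tI <-]]; exists t. Qed.

Lemma zeta_hi_gt (c : \bar R) : (c < zeta_hi U alpha)%E ->
  exists2 t, 0 < t < alpha & (c < (D t)%:E)%E.
Proof. by rewrite zeta_hiE => /ereal_sup_gt[_ [t tI <-]]; exists t. Qed.

Lemma zeta_lo_lty : (zeta_lo U < +oo)%E.
Proof.
have h : 0 < alpha / 2 < alpha by move: alpha_gt0 => ?; lra.
by rewrite (le_lt_trans (zeta_lo_le h))// ltry.
Qed.

Lemma zeta_hi_gtNy : (-oo < zeta_hi U alpha)%E.
Proof.
have h : 0 < alpha / 2 < alpha by move: alpha_gt0 => ?; lra.
by rewrite (lt_le_trans _ (zeta_hi_ge h))// ltNyr.
Qed.

Lemma dU_int s : 0 < s < alpha -> dU U alpha s = (D s)%:E.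
Proof. by move=> /andP[s0 sa]; rewrite /dU leNgt s0 leNgt sa. Qed.

Lemma dU0 : dU U alpha 0 = zeta_lo U.
Proof. by rewrite /dU lexx. Qed.

Lemma dUalpha : dU U alpha alpha = zeta_hi U alpha.
Proof. by rewrite /dU lexx leNgt alpha_gt0. Qed.

Hypothesis D_cont : {in I, continuous D}.

(** Right-continuity of U' on [0, alpha[, end point included: a strict upper bound
    of U'(s) still bounds U' at some point to the right of s. *)
Lemma dU_lt s (c : R) : 0 <= s < alpha -> (dU U alpha s < c%:E)%E ->
  exists2 t, s < t < alpha & D t < c.
Proof.
move=> /andP[]; rewrite le_eqVlt => /predU1P[<- _|s0 sa].
  by rewrite dU0 => /zeta_lo_lt[t tI]; rewrite lte_fin; exists t.
rewrite dU_int ?s0// lte_fin => Dsc.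
have sI : s \in I by rewrite in_itv/= s0.
have /nbhs_ballP[e /= e0 eP] : \forall t \near s, D t < c.
  exact: (cvgr_lt (D s) (D_cont sI) _ Dsc).
pose h := minr (e / 2) ((alpha - s) / 2).
have h0 : 0 < h by rewrite lt_min; apply/andP; split; lra.
have he : h <= e / 2 by rewrite ge_min lexx.
have ha : h <= (alpha - s) / 2 by rewrite ge_min lexx orbT.
exists (s + h); first by lra.
by apply: eP; rewrite /ball/= opprD addNKr normrN gtr0_norm//; lra.
Qed.

Lemma dU_gt s (c : R) : 0 < s <= alpha -> (c%:E < dU U alpha s)%E ->
  exists2 t, 0 < t < s & c < D t.
Proof.
move=> /andP[s0]; rewrite le_eqVlt => /predU1P[->|sa].
  by rewrite dUalpha => /zeta_hi_gt[t tI]; rewrite lte_fin; exists t.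
rewrite dU_int ?s0// lte_fin => Dsc.
have sI : s \in I by rewrite in_itv/= s0.
have /nbhs_ballP[e /= e0 eP] : \forall t \near s, c < D t.
  exact: (cvgr_gt (D s) (D_cont sI) _ Dsc).
pose h := minr (e / 2) (s / 2).
have h0 : 0 < h by rewrite lt_min; apply/andP; split; lra.
have he : h <= e / 2 by rewrite ge_min lexx.
have ha : h <= s / 2 by rewrite ge_min lexx orbT.
exists (s - h); first by lra.
by apply: eP; rewrite /ball/= opprB addrC subrK gtr0_norm//; lra.
Qed.

Section convexity.
Hypothesis U_cont : {within `[0, alpha], continuous U}.
Hypothesis U_diff : forall s, 0 < s < alpha -> derivable U s 1.

Lemma convex_MVT a b : 0 <= a -> a < b -> b <= alpha ->
  exists2 c, a < c < b & U b - U a = D c * (b - a).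
Proof.
move=> a0 ab ba.
have [||c] := @MVT R U D a b ab.
- move=> x; rewrite in_itv/= => xab; rewrite derive1E; apply/derivableP/U_diff.
  by lra.
- by apply: continuous_subspaceW U_cont => x /=; rewrite !in_itv/=; lra.
by rewrite in_itv/=; exists c.
Qed.

(** The tangent bound is taken at q instead of at r: it is uniform in r, and it
    makes sense at r = 0 even when U'(0+) is infinite. *)
Lemma convex_step_up r h q : 0 <= r -> 0 <= h -> r + h <= q -> q < alpha ->
  U (r + h) - U r <= h * D q.
Proof.
move=> r0; rewrite le_eqVlt => /predU1P[<-|h0] rhq qa.
  by rewrite addr0 subrr mul0r.
have [|||c cI ->] := @convex_MVT r (r + h); try by lra.
rewrite addrAC subrr add0r mulrC ler_pM2l//.
by apply: D_le; rewrite ?in_itv/=; lra.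
Qed.

Lemma convex_step_down r h q : r <= alpha -> 0 <= h -> 0 < q -> q <= r - h ->
  U (r - h) - U r <= - (h * D q).
Proof.
move=> r0; rewrite le_eqVlt => /predU1P[<-|h0] q0 qrh.
  by rewrite subr0 subrr mul0r oppr0.
have [|||c cI] := @convex_MVT (r - h) r; try by lra.
rewrite opprB addrCA subrr addr0 => UE.
rewrite -opprB UE lerN2 mulrC ler_pM2r//.
by apply: D_le; rewrite ?in_itv/=; lra.
Qed.

End convexity.

Section inverse_slope.
Hypothesis D_inj : {in I &, injective D}.
Local Notation T := (T_dU_inv U alpha).

Lemma slope_lt s t : 0 < s < alpha -> 0 < t < alpha -> (D s < D t) = (s < t).
Proof.
move=> sI tI; apply/idP/idP => [|st].
  by apply: contraTT; rewrite -!leNgt => ts; apply: D_le; rewrite ?in_itv.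
rewrite lt_neqAle D_le ?in_itv//= ?andbT; last exact: ltW.
by apply: contraTneq st => /D_inj ->; rewrite ?in_itv// ltxx.
Qed.

Lemma zeta_lo_slope t : 0 < t < alpha -> (zeta_lo U < (D t)%:E)%E.
Proof.
move=> tI; have hI : 0 < t / 2 < alpha by lra.
by apply: le_lt_trans (zeta_lo_le hI) _; rewrite lte_fin slope_lt//; lra.
Qed.

Lemma zeta_hi_slope t : 0 < t < alpha -> ((D t)%:E < zeta_hi U alpha)%E.
Proof.
move=> tI; have hI : 0 < (t + alpha) / 2 < alpha by lra.
by apply: lt_le_trans (zeta_hi_ge hI); rewrite lte_fin slope_lt//; lra.
Qed.

Lemma T_dU_inv_hi z : (zeta_hi U alpha <= z%:E)%E -> T z = alpha.
Proof. by rewrite /T_dU_inv => ->. Qed.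

Lemma T_dU_inv_lo z : (z%:E <= zeta_lo U)%E -> T z = 0.
Proof.
move=> zlo; rewrite /T_dU_inv zlo ifF//; apply/negbTE; rewrite -ltNge.
have hI : 0 < alpha / 2 < alpha by move: alpha_gt0 => ?; lra.
exact: le_lt_trans (lt_trans (zeta_lo_slope hI) (zeta_hi_slope hI)).
Qed.

Lemma T_dU_invK s : 0 < s < alpha -> T (D s) = s.
Proof.
move=> sI; rewrite /T_dU_inv leNgt zeta_hi_slope//= leNgt zeta_lo_slope//=.
by rewrite pinvKV ?inE//= ?in_itv// => x y; rewrite !inE; exact: D_inj.
Qed.

(** The third case is the intermediate value theorem for U'. *)
Lemma T_dU_inv_cases z : [\/ (z%:E <= zeta_lo U)%E /\ T z = 0,
  (zeta_hi U alpha <= z%:E)%E /\ T z = alpha |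
  exists2 t, 0 < t < alpha & D t = z].
Proof.
have [|zlo] := leP z%:E (zeta_lo U).
  by move=> h; constructor 1; rewrite T_dU_inv_lo.
have [|zhi] := leP (zeta_hi U alpha) z%:E.
  by move=> h; constructor 2; rewrite T_dU_inv_hi.
constructor 3.
have [a aI] := zeta_lo_lt zlo; rewrite lte_fin => Daz.
have [b bI] := zeta_hi_gt zhi; rewrite lte_fin => zDb.
have ab : a < b by rewrite -slope_lt//; exact: lt_trans zDb.
have [||c] := @IVT R D a b z (ltW ab).
- have Dab : {in `[a, b], continuous D}.
    move=> x; rewrite inE/= in_itv/= => xab.
    by apply: D_cont; rewrite in_itv/=; lra.
  exact: continuous_in_subspaceT Dab.
- by rewrite ge_min le_max (ltW Daz) (ltW zDb) orbT.
by rewrite in_itv/= => cab <-; exists c => //; lra.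
Qed.

(** Monotonicity, continuity and strict growth of T all follow from this order
    duality with U' and from its counterpart T_dU_inv_gtE. *)
Lemma T_dU_inv_ltE s z : 0 < s < alpha -> (T z < s) = (z < D s).
Proof.
move=> sI; have [[zlo ->]|[zhi ->]|[t tI <-]] := T_dU_inv_cases z.
- rewrite -[RHS]lte_fin (le_lt_trans zlo (zeta_lo_slope sI)).
  by case/andP: sI.
- rewrite -[RHS]lte_fin [RHS]ltNge (le_trans (ltW (zeta_hi_slope sI)) zhi)/=.
  by apply/negbTE; rewrite -leNgt ltW//; case/andP: sI.
by rewrite T_dU_invK// slope_lt.
Qed.

Lemma T_dU_inv_gtE s z : 0 < s < alpha -> (s < T z) = (D s < z).
Proof.
move=> sI; have [[zlo ->]|[zhi ->]|[t tI <-]] := T_dU_inv_cases z.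
- rewrite -[RHS]lte_fin [RHS]ltNge (le_trans zlo (ltW (zeta_lo_slope sI)))/=.
  by apply/negbTE; rewrite -leNgt ltW//; case/andP: sI.
- rewrite -[RHS]lte_fin (lt_le_trans (zeta_hi_slope sI) zhi).
  by case/andP: sI.
by rewrite T_dU_invK// slope_lt.
Qed.

Lemma T_dU_inv_bounds z : 0 <= T z <= alpha.
Proof.
have [[_ ->]|[_ ->]|[t tI <-]] := T_dU_inv_cases z.
- by rewrite lexx ltW.
- by rewrite lexx ltW.
by rewrite T_dU_invK//; lra.
Qed.

Lemma T_dU_inv_homo : {homo T : x y / x <= y}.
Proof.
move=> x y xy; rewrite leNgt; apply/negP => Tyx.
have /andP[y0 _] := T_dU_inv_bounds y; have /andP[_ xa] := T_dU_inv_bounds x.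
pose s := (T y + T x) / 2.
have sI : 0 < s < alpha by rewrite /s; lra.
have : T y < s by rewrite /s; lra.
have : s < T x by rewrite /s; lra.
by rewrite T_dU_inv_ltE// T_dU_inv_gtE//; lra.
Qed.

Lemma T_dU_inv_inj_interior x y : 0 < T x < alpha -> T x = T y -> x = y.
Proof.
move=> TI Txy; have xE : x = D (T x).
  apply/eqP; rewrite eq_le !leNgt -T_dU_inv_ltE// -T_dU_inv_gtE// ltxx//.
rewrite Txy in TI xE; rewrite xE; apply/eqP.
by rewrite eq_le !leNgt -T_dU_inv_ltE// -T_dU_inv_gtE// ltxx.
Qed.

(** By the two order dualities, the preimages under T of the rays ending in
    (0, alpha) are open rays. *)
Lemma T_dU_inv_continuous : continuous T.
Proof.
move=> z; apply/cvgrPdist_lt => e e0.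
have /andP[z0 za] := T_dU_inv_bounds z.
have lo : \forall x \near z, T z - e < T x.
  have [neg|pos] := ltP (T z - e) 0.
    by near=> x; have /andP[? _] := T_dU_inv_bounds x; lra.
  pose s := T z - e / 2.
  have sI : 0 < s < alpha by rewrite /s; lra.
  have Dsz : D s < z by rewrite -T_dU_inv_gtE// /s; lra.
  near=> x; apply: (@lt_trans _ _ s); first by rewrite /s; lra.
  by rewrite T_dU_inv_gtE//; near: x; exact: lt_nbhsr.
have hi : \forall x \near z, T x < T z + e.
  have [big|pos] := ltP alpha (T z + e).
    by near=> x; have /andP[_ ?] := T_dU_inv_bounds x; lra.
  pose s := T z + e / 2.
  have sI : 0 < s < alpha by rewrite /s; lra.
  have zDs : z < D s by rewrite -T_dU_inv_ltE// /s; lra.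
  near=> x; apply: (@lt_trans _ _ s); last by rewrite /s; lra.
  by rewrite T_dU_inv_ltE//; near: x; exact: lt_nbhsl.
near=> x; rewrite ltr_norml.
have : T z - e < T x by near: x.
have : T x < T z + e by near: x.
by move=> *; apply/andP; split; lra.
Unshelve. all: by end_near. Qed.

End inverse_slope.
End extended_slope.

(** * Euler-Lagrange inequalities for local minimisers *)

Section euler_lagrange.
Context {R : realType} (d : nat) (Omega : set 'rV[R]_d) (alpha M K : R)
  (U : R -> R) (V rho : 'rV[R]_d -> R).
Local Notation D := (derive1 U).
Local Notation I := `]0, alpha[%R.
Local Notation mu := (lebesgue_rV d).
Hypothesis alpha_gt0 : 0 < alpha.
Hypothesis D_le : {in I &, {homo D : x y / x <= y}}.
Hypothesis D_cont : {in I, continuous D}.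
Hypothesis U_cont : {within `[0, alpha], continuous U}.
Hypothesis U_diff : forall s, 0 < s < alpha -> derivable U s 1.
Hypotheses (mO : measurable Omega) (Ofin : (mu Omega < +oo)%E).
Hypothesis mV : measurable_fun Omega V.
Hypothesis V_le : forall x, Omega x -> `|V x| <= K.
Hypothesis rho_min : L1_local_minimiser Omega (energy U V Omega)
  (calA_mass Omega alpha M) rho.

Definition clip (s : R) := maxr 0 (minr alpha s).
(** U o rho0 is measurable on Omega, whereas U o rho may fail to be. *)
Definition rho0 := clip \o rho.

Lemma clip_bounds s : 0 <= clip s <= alpha.
Proof.
by rewrite /clip le_max lexx/= ge_max ge_min lexx/= andbT ltW.
Qed.

Lemma clip_id s : 0 <= s <= alpha -> clip s = s.
Proof. by move=> /andP[s0 sa]; rewrite /clip min_r// max_r. Qed.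

Lemma rho_bounds : {ae mu, forall x, Omega x -> 0 <= rho x <= alpha}.
Proof. by case: rho_min => -[[]]. Qed.

Lemma rho0E : {ae mu, forall x, Omega x -> rho x = rho0 x}.
Proof. by apply: filterS rho_bounds => x h Ox; rewrite /rho0/= clip_id//; exact: h. Qed.

Lemma measurable_rho0 : measurable_fun Omega rho0.
Proof.
case: rho_min => -[[/integrableP[/measurable_EFinP mrho _] _] _] _.
apply: measurable_maxr; first exact: measurable_cst.
by apply: measurable_minr => //; exact: measurable_cst.
Qed.

Definition admissible (f : 'rV[R]_d -> R) :=
  measurable_fun Omega f /\ forall x, Omega x -> 0 <= f x <= alpha.

Lemma admissible_rho0 : admissible rho0.
Proof. by split=> [|x _]; [exact: measurable_rho0|exact: clip_bounds]. Qed.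

Lemma admissible_integrable f : admissible f -> mu.-integrable Omega (EFin \o f).
Proof.
move=> [mf f0a]; apply: (@bounded_integrable _ _ _ _ _ mO Ofin _ alpha) => // x Ox.
by have /andP[? ?] := f0a _ Ox; rewrite ger0_norm.
Qed.

Lemma admissible_L1norm f : admissible f ->
  L1norm Omega f = \int[mu]_(x in Omega) f x.
Proof.
move=> [_ f0a]; apply: eq_Rintegral => x /set_mem Ox.
by have /andP[? ?] := f0a _ Ox; rewrite ger0_norm.
Qed.

Lemma admissible_integrable_U f : admissible f ->
  mu.-integrable Omega (EFin \o (fun x => U (f x))).
Proof.
move=> [mf f0a]; have [L UL] := continuous_segment_bounded (ltW alpha_gt0) U_cont.
apply: (@bounded_integrable _ _ _ _ _ mO Ofin _ L).
  exact: (measurable_comp_segment U_cont).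
by move=> x Ox; apply: UL; exact: f0a.
Qed.

Lemma admissible_integrable_V f : admissible f ->
  mu.-integrable Omega (EFin \o (fun x => V x * f x)).
Proof.
move=> [mf f0a]; apply: (@bounded_integrable _ _ _ _ _ mO Ofin _ (K * alpha)).
  exact: measurable_funM.
move=> x Ox; rewrite normrM; apply: ler_pM => //; first exact: V_le.
by have /andP[? ?] := f0a _ Ox; rewrite ger0_norm.
Qed.

Lemma energyE f : admissible f ->
  energy U V Omega f = \int[mu]_(x in Omega) (U (f x) + V x * f x).
Proof.
move=> af; rewrite RintegralD//; first exact: admissible_integrable_U.
exact: admissible_integrable_V.
Qed.

Lemma energy_rho0 : energy U V Omega rho = energy U V Omega rho0.
Proof.
by congr (_ + _); apply: ae_eq_Rintegral; apply: filterS rho0E => x h Ox; rewrite h.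
Qed.

Lemma rho0_mass : \int[mu]_(x in Omega) rho0 x = M.
Proof.
case: rho_min => -[_ <-] _; rewrite -admissible_L1norm; last exact: admissible_rho0.
by apply: ae_eq_Rintegral; apply: filterS rho0E => x h Ox; rewrite h.
Qed.

Lemma rho0_min : exists2 e : R, 0 < e & forall f, admissible f ->
  \int[mu]_(x in Omega) f x = M -> \int[mu]_(x in Omega) `|f x - rho0 x| < e ->
  energy U V Omega rho0 <= energy U V Omega f.
Proof.
case: rho_min => _ [e e0 rmin]; exists e => // f af fM fe.
rewrite -energy_rho0; apply: rmin.
  split; last by rewrite admissible_L1norm.
  by split; [exact: admissible_integrable|apply: aeW => x; case: af => _; exact].
suff -> : L1norm Omega (f \- rho) = \int[mu]_(x in Omega) `|f x - rho0 x| by [].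
by apply: ae_eq_Rintegral; apply: filterS rho0E => x h Ox; rewrite /= h.
Qed.

(** By the two convexity steps, moving the mass dl from B to A changes the energy
    by at most dl * (c - c') < 0. *)
Lemma mass_exchange (A B : set 'rV[R]_d) (p q p' q' c c' : R) :
  measurable A -> A `<=` Omega -> measurable B -> B `<=` Omega ->
  p < q -> q < alpha -> (forall x, A x -> rho0 x <= p /\ D q + V x <= c) ->
  0 < q' -> q' < p' -> (forall x, B x -> p' <= rho0 x /\ c' <= D q' + V x) ->
  c < c' -> (0 < mu A)%E -> (0 < mu B)%E -> False.
Proof.
move=> mA AO mB BO pq qa Ap q0' qp' Bp cc' muA muB.
have fin_mass (C : set 'rV[R]_d) : measurable C -> C `<=` Omega ->
    (0 < mu C)%E -> 0 < fine (mu C).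
  move=> mC CO C0; rewrite fine_gt0// C0/=; apply: le_lt_trans Ofin.
  by apply: le_measure; rewrite ?inE.
have a0 := fin_mass _ mA AO muA; have b0 := fin_mass _ mB BO muB.
set a := fine (mu A) in a0; set b := fine (mu B) in b0.
have rho0_bd x : 0 <= rho0 x <= alpha by exact: clip_bounds.
(* at a common point q' < p' <= rho0 <= p < q, so that U'(q') <= U'(q), and then
   c' <= U'(q') + V <= U'(q) + V <= c *)
have AB x : A x -> ~ B x.
  move=> Ax Bx; have [h1 h2] := Ap _ Ax; have [h3 h4] := Bp _ Bx.
  have h5 := rho0_bd x.
  suff : D q' <= D q by lra.
  by apply: D_le; rewrite ?in_itv/=; lra.
have [e e0 rmin] := rho0_min.
(* the L^1 distance to rho0 will be 2 * dl, and the heights dl / a and dl / b of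
   the two steps have to fit in the gaps q - p and p' - q' *)
pose dl := minr (e / 3) (minr (a * (q - p)) (b * (p' - q'))).
have dl0 : 0 < dl.
  rewrite !lt_min; apply/and3P; split; first by lra.
    by rewrite mulr_gt0// subr_gt0.
  by rewrite mulr_gt0// subr_gt0.
have dle : dl <= e / 3 by rewrite ge_min lexx.
have dla : dl <= a * (q - p) by rewrite !ge_min lexx orbT.
have dlb : dl <= b * (p' - q') by rewrite !ge_min lexx !orbT.
pose h := dl / a; pose h' := dl / b.
have h0 : 0 < h by rewrite divr_gt0.
have h'0 : 0 < h' by rewrite divr_gt0.
have hpq : h <= q - p by rewrite ler_pdivrMr// mulrC.
have hpq' : h' <= p' - q' by rewrite ler_pdivrMr// mulrC.
pose f x := rho0 x + (h * \1_A x - h' * \1_B x).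
have fA x : A x -> f x = rho0 x + h.
  move=> Ax; rewrite /f !indicE mem_set// memNset//; last exact: AB.
  by rewrite mulr1 mulr0 subr0.
have fB x : B x -> f x = rho0 x - h'.
  move=> Bx; rewrite /f !indicE (mem_set Bx) memNset//.
    by rewrite mulr1 mulr0 sub0r.
  by move=> /AB.
have fN x : ~ A x -> ~ B x -> f x = rho0 x.
  by move=> nA nB; rewrite /f !indicE !memNset// !mulr0 subr0 addr0.
have mind (C : set 'rV[R]_d) k : measurable C ->
    measurable_fun Omega (fun x => k * \1_C x : R).
  by move=> mC; apply: measurable_funM => //; exact: measurable_indic.
have iind (C : set 'rV[R]_d) k : measurable C ->
    mu.-integrable Omega (EFin \o (fun x => k * \1_C x : R)).
  move=> mC; apply: (@bounded_integrable _ _ _ _ _ mO Ofin _ `|k|); first exact: mind.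
  move=> x _; rewrite normrM indicE; case: (_ \in _); rewrite ?normr1 ?mulr1//.
  by rewrite normr0 mulr0.
have af : admissible f.
  split.
    apply: measurable_funD; first exact: measurable_rho0.
    by apply: measurable_funB; exact: mind.
  move=> x Ox; have := rho0_bd x.
  have [Ax|nA] := pselect (A x); first by rewrite fA//; have [] := Ap _ Ax; lra.
  have [Bx|nB] := pselect (B x); first by rewrite fB//; have [] := Bp _ Bx; lra.
  by rewrite fN.
have ind_int k k' :
    \int[mu]_(x in Omega) (k * \1_A x - k' * \1_B x) = k * a - k' * b.
  by rewrite RintegralB ?Rintegral_indicZ//; exact: iind.
have ha : h * a = dl by rewrite /h divfK// gt_eqF.
have hb : h' * b = dl by rewrite /h' divfK// gt_eqF.
have iAB k k' :
    mu.-integrable Omega (EFin \o (fun x => k * \1_A x - k' * \1_B x : R)).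
  rewrite (_ : _ \o _ = (EFin \o (fun x => k * \1_A x)%R) \-
    (EFin \o (fun x => k' * \1_B x)%R))%E //.
  by apply: integrableB => //; exact: iind.
have fM : \int[mu]_(x in Omega) f x = M.
  rewrite RintegralD//; last exact: admissible_integrable admissible_rho0.
  by rewrite ind_int rho0_mass ha hb subrr addr0.
have fe : \int[mu]_(x in Omega) `|f x - rho0 x| < e.
  apply: (@le_lt_trans _ _ (\int[mu]_(x in Omega) (h * \1_A x - (- h') * \1_B x))).
    apply: le_Rintegral => //.
      rewrite (_ : _ \o _ = abse \o (EFin \o (fun x => f x - rho0 x)))//.
      apply: integrable_abse.
      by under eq_fun do rewrite /f addrAC subrr add0r; exact: iAB.
    move=> x _; rewrite /f addrAC subrr add0r mulNr opprK.
    by apply: le_trans (ler_normB _ _) _; rewrite !ger0_norm// mulr_ge0// ltW.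
  by rewrite ind_int ha mulNr hb; lra.
have := rmin _ af fM fe; apply/negP; rewrite -ltNge.
rewrite !energyE//; last exact: admissible_rho0.
have iE g : admissible g ->
    mu.-integrable Omega (EFin \o (fun x => U (g x) + V x * g x)).
  move=> ag; rewrite (_ : _ \o _ = (EFin \o (fun x => U (g x))%R) \+
    (EFin \o (fun x => V x * g x)%R))%E //.
  apply: integrableD => //; first exact: admissible_integrable_U.
  exact: admissible_integrable_V.
apply: (@le_lt_trans _ _ (\int[mu]_(x in Omega) (U (rho0 x) + V x * rho0 x +
    ((c * h) * \1_A x - (c' * h') * \1_B x)))).
  apply: le_Rintegral => //; first exact: iE.
    rewrite (_ : _ \o _ = (EFin \o (fun x => U (rho0 x) + V x * rho0 x)%R) \+
      (EFin \o (fun x => ((c * h) * \1_A x - (c' * h') * \1_B x))%R))%E //.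
    by apply: integrableD => //; apply: iE; exact: admissible_rho0.
  move=> x Ox; have := rho0_bd x.
  have [Ax|nA] := pselect (A x).
    rewrite fA// !indicE mem_set// memNset//; last exact: AB.
    have [r1 r2] := Ap _ Ax; move=> /andP[r3 _].
    have := @convex_step_up _ _ _ D_le U_cont U_diff (rho0 x) h q r3 (ltW h0) _ qa.
    have : h * (D q + V x) <= h * c by rewrite ler_pM2l.
    rewrite mulr1 mulr0 subr0 !mulrDr (mulrC (V x) h) (mulrC c) => s1 s2.
    by have := s2 _; lra.
  have [Bx|nB] := pselect (B x).
    rewrite fB// !indicE (mem_set Bx) memNset//.
    have [r1 r2] := Bp _ Bx; move=> /andP[_ r3].
    have := @convex_step_down _ _ _ D_le U_cont U_diff (rho0 x) h' q' r3 (ltW h'0) q0' _.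
    have : h' * c' <= h' * (D q' + V x) by rewrite ler_pM2l.
    rewrite mulr1 mulr0 sub0r mulrDr mulrBr (mulrC (V x) h') (mulrC c') => s1 s2.
    by have := s2 _; lra.
  by rewrite fN// !indicE !memNset// !mulr0 subr0 addr0.
rewrite RintegralD//; last by apply: iE; exact: admissible_rho0.
rewrite ind_int -(mulrA c) -(mulrA c') ha hb gtrDl -mulrBl.
by rewrite nmulr_rlt0// subr_lt0.
Qed.

(** The first variation of the energy at rho. *)
Definition pot x : \bar R := (dU U alpha (rho x) + (V x)%:E)%E.

Definition lower_pot c :=
  {ae mu, forall x, Omega x -> 0 <= rho x < alpha -> (c%:E <= pot x)%E}.

Definition upper_pot c :=
  {ae mu, forall x, Omega x -> 0 < rho x <= alpha -> (pot x <= c%:E)%E}.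

Lemma sublevel_measurable c p :
  measurable (Omega `&` [set x | rho0 x <= p] `&` [set x | V x < c]).
Proof.
rewrite -setIA setIIr; apply: measurableI.
  have := measurable_rho0 mO (measurable_itv `]-oo, p]%R).
  by congr (measurable (_ `&` _)); apply/seteqP; split=> x /=; rewrite in_itv.
have := mV mO (measurable_itv `]-oo, c[%R).
by congr (measurable (_ `&` _)); apply/seteqP; split=> x /=; rewrite in_itv.
Qed.

Lemma superlevel_measurable c p :
  measurable (Omega `&` [set x | p <= rho0 x] `&` [set x | c < V x]).
Proof.
rewrite -setIA setIIr; apply: measurableI.
  have := measurable_rho0 mO (measurable_itv `[p, +oo[%R).
  by congr (measurable (_ `&` _)); apply/seteqP; split=> x /=; rewrite in_itv/= andbT.
have := mV mO (measurable_itv `]c, +oo[%R).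
by congr (measurable (_ `&` _)); apply/seteqP; split=> x /=; rewrite in_itv/= andbT.
Qed.

(** The two families of sets between which mass is exchanged.  Fixing q replaces the
    condition on U'(rho) by a condition on V alone. *)
Definition lowA c p q :=
  Omega `&` [set x | rho0 x <= p] `&` [set x | V x < c - D q].
Definition highB c p q :=
  Omega `&` [set x | p <= rho0 x] `&` [set x | c - D q < V x].

(** If rho(x) < alpha and U'(rho(x)) + V(x) < c, then U'(q) < c - V(x) for some
    rational q > rho(x), and any rational p in between puts x in lowA c p q. *)
Lemma lower_pot_null c :
  (forall p q : R, p < q -> q < alpha -> mu (lowA c p q) = 0%E) -> lower_pot c.
Proof.
move=> null.
have : {ae mu, forall x, forall pq : rat * rat,
    ratr pq.1 < ratr pq.2 :> R -> ratr pq.2 < alpha ->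
    ~ lowA c (ratr pq.1) (ratr pq.2) x}.
  apply: ae_forall_countable => -[p q] /=.
  have [pq|] := pselect (ratr p < ratr q :> R); last by move=> h; apply: aeW => x.
  have [qa|] := pselect (ratr q < alpha); last by move=> h; apply: aeW => x.
  have := ae_notin_null (sublevel_measurable _ _) (null _ _ pq qa).
  by apply: filterS => x h _ _.
apply: filterS2 rho0E => x hrho null_x Ox rhoI; rewrite /pot leNgt.
apply/negP; rewrite -lteBrDr// -EFinB => /(dU_lt alpha_gt0 D_le D_cont rhoI)[t tI Dt].
have /rat_in_itvoo[q] : rho x < t by case/andP: tI.
rewrite in_itv/= => /andP[rq qt].
have /rat_in_itvoo[p] := rq; rewrite in_itv/= => /andP[rp pq].
apply: (null_x (p, q)) => //=; first by lra.
split; first by split => //=; rewrite -hrho// ltW.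
suff : D (ratr q) <= D t by rewrite /=; lra.
by apply: D_le; rewrite ?in_itv/=; lra.
Qed.

(** Mirror image of lower_pot_null, with rational q < p < rho(x). *)
Lemma upper_pot_null c :
  (forall p q : R, 0 < q -> q < p -> mu (highB c p q) = 0%E) -> upper_pot c.
Proof.
move=> null.
have : {ae mu, forall x, forall pq : rat * rat,
    0 < ratr pq.2 :> R -> ratr pq.2 < ratr pq.1 :> R ->
    ~ highB c (ratr pq.1) (ratr pq.2) x}.
  apply: ae_forall_countable => -[p q] /=.
  have [q0|] := pselect (0 < ratr q :> R); last by move=> h; apply: aeW => x.
  have [qp|] := pselect (ratr q < ratr p :> R); last by move=> h; apply: aeW => x.
  have := ae_notin_null (superlevel_measurable _ _) (null _ _ q0 qp).
  by apply: filterS => x h _ _.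
apply: filterS2 rho0E => x hrho null_x Ox rhoI; rewrite /pot leNgt.
apply/negP; rewrite -lteBlDr// -EFinB => /(dU_gt alpha_gt0 D_le D_cont rhoI)[t tI Dt].
have /rat_in_itvoo[q] : t < rho x by case/andP: tI.
rewrite in_itv/= => /andP[tq qr].
have /rat_in_itvoo[p] := qr; rewrite in_itv/= => /andP[qp pr].
apply: (null_x (p, q)) => //=; first by lra.
split; first by split => //=; rewrite -hrho// ltW.
suff : D t <= D (ratr q) by rewrite /=; lra.
by apply: D_le; rewrite ?in_itv/=; lra.
Qed.

Lemma lower_or_upper c c' : c < c' -> lower_pot c \/ upper_pot c'.
Proof.
move=> cc'.
have [hA|/existsNP[p /existsNP[q /not_implyP[pq /not_implyP[qa Apos]]]]] :=
  pselect (forall p q : R, p < q -> q < alpha -> mu (lowA c p q) = 0%E).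
  by left; exact: lower_pot_null.
right; apply: upper_pot_null => p' q' q'0 qp'; apply: contrapT => Bpos.
have pos (C : set 'rV[R]_d) : ~ mu C = 0%E -> (0 < mu C)%E.
  by move=> /eqP; rewrite lt_neqAle measure_ge0 andbT eq_sym.
apply: (@mass_exchange (lowA c p q) (highB c' p' q') p q p' q' c c') => //.
- exact: sublevel_measurable.
- by move=> x [[]].
- exact: superlevel_measurable.
- by move=> x [[]].
- by move=> x [[_ /= h1] /= h2]; split => //; lra.
- by move=> x [[_ /= h1] /= h2]; split => //; lra.
- exact: pos.
- exact: pos.
Qed.

Lemma lower_pot_le c c' : c <= c' -> lower_pot c' -> lower_pot c.
Proof.
move=> cc'; apply: filterS => x h Ox xI; apply: le_trans (h Ox xI).
by rewrite lee_fin.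
Qed.

Lemma pot_gtNy x : 0 < rho x <= alpha -> (-oo < pot x)%E.
Proof.
move=> /andP[r0]; rewrite /pot le_eqVlt => /predU1P[->|ra].
  rewrite dUalpha//; have := zeta_hi_gtNy alpha_gt0 D_le.
  by case: (zeta_hi U alpha) => [z _|_|//]; rewrite ?addye// ltNyr.
by rewrite dU_int ?r0// -EFinD ltNyr.
Qed.

Lemma pot_lty x : 0 <= rho x < alpha -> (pot x < +oo)%E.
Proof.
move=> /andP[]; rewrite /pot le_eqVlt => /predU1P[<- _|r0 ra].
  by rewrite dU0 lte_add_pinfty ?ltry// (zeta_lo_lty alpha_gt0 D_le).
by rewrite dU_int ?r0// -EFinD ltry.
Qed.

(** The potential would be infinite where rho < alpha, but U' is finite or -oo
    there. *)
Lemma lower_pot_all : (forall c, lower_pot c) ->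
  {ae mu, forall x, Omega x -> rho x = alpha}.
Proof.
move=> h; have : {ae mu, forall x, forall n : nat, Omega x ->
    0 <= rho x < alpha -> (n%:R%:E <= pot x)%E} by apply: ae_foralln => n; exact: h.
apply: filterS2 rho_bounds => x rI hx Ox; have /andP[r0 ra] := rI Ox.
apply/eqP; rewrite eq_le ra leNgt; apply/negP => ra'.
have rI' : 0 <= rho x < alpha by rewrite r0.
have := pot_lty rI'; apply/negP; rewrite -leNgt leye_eq; apply/eqP/eqyP => A A0.
apply: le_trans (hx (truncn A).+1 Ox rI').
by rewrite lee_fin ltW// truncnS_gt.
Qed.

Lemma upper_pot_all : (forall c, upper_pot c) ->
  {ae mu, forall x, Omega x -> rho x = 0}.
Proof.
move=> h; have : {ae mu, forall x, forall n : nat, Omega x ->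
    0 < rho x <= alpha -> (pot x <= (- n%:R)%:E)%E} by apply: ae_foralln => n; exact: h.
apply: filterS2 rho_bounds => x rI hx Ox; have /andP[r0 ra] := rI Ox.
apply/eqP; rewrite eq_le r0 andbT leNgt; apply/negP => r0'.
have rI' : 0 < rho x <= alpha by rewrite r0'.
have := pot_gtNy rI'; apply/negP; rewrite -leNgt leeNy_eq -[-oo%E]/(- +oo)%E.
rewrite -eqe_oppLR; apply/eqP/eqyP => A A0.
rewrite leeNr; apply: le_trans (hx (truncn A).+1 Ox rI') _.
by rewrite lee_fin lerN2 ltW// truncnS_gt.
Qed.

Lemma lower_pot_lim c : (forall n : nat, lower_pot (c - n.+1%:R^-1)) -> lower_pot c.
Proof.
move=> /ae_foralln; apply: filterS => x h Ox rI; apply/lee_subgt0Pr => e e0.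
have /= [n _ /(_ _ (leqnn _)) ne] := near_infty_natSinv_lt (PosNum e0).
by apply: le_trans (h n Ox rI); rewrite -EFinB lee_fin; rewrite lerB// ltW.
Qed.

Lemma upper_pot_lim c : (forall n : nat, upper_pot (c + n.+1%:R^-1)) -> upper_pot c.
Proof.
move=> /ae_foralln; apply: filterS => x h Ox rI; apply/lee_addgt0Pr => e e0.
have /= [n _ /(_ _ (leqnn _)) ne] := near_infty_natSinv_lt (PosNum e0).
by apply: le_trans (h n Ox rI) _; rewrite -EFinD lee_fin; rewrite lerD// ltW.
Qed.

Lemma mass_ae_cst r : 0 <= r -> {ae mu, forall x, Omega x -> rho x = r} ->
  M = r * volume Omega.
Proof.
move=> r0 h; case: rho_min => -[_ <-] _.
rewrite -(Rintegral_cst _ mO); apply: ae_eq_Rintegral.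
by apply: filterS h => x h Ox; rewrite h// ger0_norm.
Qed.

(** The threshold is the supremum of the a.e. lower bounds: any number above it is
    not a lower bound, hence everything still larger is an upper bound by
    lower_or_upper.  The supremum exists unless rho is a.e. 0 or a.e. alpha, and
    then one of the two conditions is void. *)
Lemma pot_threshold : (M = 0 -> zeta_lo U <> -oo%E) ->
  (M = alpha * volume Omega -> zeta_hi U alpha <> +oo%E) ->
  exists C, lower_pot C /\ upper_pot C.
Proof.
move=> M0 Ma.
have [r0|nr0] := pselect ({ae mu, forall x, Omega x -> rho x = 0}).
  have M_0 : M = 0 by rewrite (mass_ae_cst (lexx 0) r0) mul0r.
  have lo_fin : zeta_lo U \is a fin_num.
    rewrite fin_numE; apply/andP; split; first exact/eqP/M0.
    by rewrite lt_eqF// (zeta_lo_lty alpha_gt0 D_le).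
  exists (fine (zeta_lo U) - K); split; apply: filterS r0 => x rx Ox; last first.
    by rewrite rx// ltxx.
  move=> _; rewrite /pot rx// dU0 EFinB fineK// leeD2l// lee_fin.
  by have := V_le Ox; rewrite ler_norml => /andP[]; lra.
have [ra|nra] := pselect ({ae mu, forall x, Omega x -> rho x = alpha}).
  have M_a := mass_ae_cst (ltW alpha_gt0) ra.
  have hi_fin : zeta_hi U alpha \is a fin_num.
    rewrite fin_numE; apply/andP; split; last exact/eqP/Ma.
    by rewrite gt_eqF// (zeta_hi_gtNy alpha_gt0 D_le).
  exists (fine (zeta_hi U alpha) + K); split; apply: filterS ra => x rx Ox.
    by rewrite rx// ltxx andbF.
  move=> _; rewrite /pot rx// dUalpha// EFinD fineK// leeD2l// lee_fin.
  by have := V_le Ox; rewrite ler_norml => /andP[].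
pose E := [set c | lower_pot c].
have E0 : E !=set0.
  apply: contrapT => nE; apply: nr0; apply: upper_pot_all => c.
  have c1 : c - 1 < c by lra.
  have [h|//] := lower_or_upper c1.
  by exfalso; apply: nE; exists (c - 1).
have supE : has_sup E.
  split=> //; apply: contrapT => ubE; apply: nra; apply: lower_pot_all => c.
  apply: contrapT => nc; apply: ubE; exists c => c1 Ec1.
  by rewrite leNgt; apply/negP => cc1; apply: nc; exact: lower_pot_le (ltW cc1) Ec1.
exists (sup E); split.
  apply: lower_pot_lim => n.
  have n0 : 0 < n.+1%:R^-1 :> R by rewrite invr_gt0.
  have [c Ec hc] := sup_adherent n0 supE.
  exact: lower_pot_le (ltW hc) Ec.
apply: upper_pot_lim => n.
have n0 : 0 < n.+1%:R^-1 :> R by rewrite invr_gt0.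
pose c := sup E + n.+1%:R^-1 / 2.
have cn : c < sup E + n.+1%:R^-1.
  by rewrite ltrD2l ltr_pdivrMr// ltr_pMr// ltr1n.
have [Ec|//] := lower_or_upper cn.
have : c <= sup E by apply: ub_le_sup => //; case: supE.
by rewrite /c gerDl leNgt divr_gt0.
Qed.

(** At rho(x) = 0 the lower bound says C - V(x) <= U'(0+), at rho(x) = alpha the
    upper bound says C - V(x) >= U'(alpha-), and in between C - V(x) = U'(rho(x)). *)
Lemma pot_minimiser_formula C : lower_pot C -> upper_pot C ->
  {in I &, injective D} ->
  {ae mu, forall x, Omega x -> rho x = T_dU_inv U alpha (C - V x)}.
Proof.
move=> lC uC D_inj.
apply: filterS3 rho_bounds lC uC => x rI lx ux Ox.
have {rI}rI := rI Ox; have {}lx := lx Ox; have {}ux := ux Ox.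
have [r0|r0] := eqVneq (rho x) 0.
  rewrite r0 T_dU_inv_lo//; have := lx; rewrite r0 lexx/= => /(_ alpha_gt0).
  by rewrite /pot r0 dU0 EFinB leeBlDr.
have [ra|ra] := eqVneq (rho x) alpha.
  rewrite ra T_dU_inv_hi//; have := ux; rewrite ra lexx alpha_gt0/= => /(_ isT).
  by rewrite /pot ra dUalpha// EFinB leeBrDr.
have {}rI : 0 < rho x < alpha.
  by rewrite !lt_neqAle ra eq_sym r0 /= .
have rI1 : 0 <= rho x < alpha by lra.
have rI2 : 0 < rho x <= alpha by lra.
have := lx rI1; have := ux rI2; rewrite /pot dU_int// -EFinD !lee_fin => h1 h2.
have -> : C - V x = D (rho x) by lra.
by rewrite T_dU_invK.
Qed.

End euler_lagrange.

(** * The level of prescribed mass *)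

Section prescribed_mass.
Context {R : realType} (d : nat) (Omega : set 'rV[R]_d) (alpha M K : R)
  (U : R -> R) (V : 'rV[R]_d -> R).
Local Notation D := (derive1 U).
Local Notation I := `]0, alpha[%R.
Local Notation T := (T_dU_inv U alpha).
Local Notation mu := (lebesgue_rV d).
Hypothesis alpha_gt0 : 0 < alpha.
Hypothesis D_le : {in I &, {homo D : x y / x <= y}}.
Hypothesis D_cont : {in I, continuous D}.
Hypothesis D_inj : {in I &, injective D}.
Hypotheses (oO : open Omega) (O0 : Omega !=set0) (cO : connected Omega).
Hypothesis Ofin : (mu Omega < +oo)%E.
Hypothesis V_cont : {in Omega, continuous V}.
Hypothesis V_le : forall x, Omega x -> `|V x| <= K.
Hypothesis M_bounds : 0 < M < alpha * volume Omega.

Let mO : measurable Omega := open_rV_measurable oO.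
Let T_bd z := T_dU_inv_bounds alpha_gt0 D_le D_cont D_inj z.

Lemma TV_continuous C : {in Omega, continuous (fun x => T (C - V x))}.
Proof.
move=> x Ox; apply: (@continuous_comp _ _ _ (fun x => C - V x) T).
  by apply: (@continuousB _ _ _ (cst C) V); [exact: cst_continuous|exact: V_cont].
exact: T_dU_inv_continuous.
Qed.

Lemma TV_measurable C : measurable_fun Omega (fun x => T (C - V x)).
Proof. by apply: continuous_open_measurable => //; exact: TV_continuous. Qed.

Lemma TV_integrable C : mu.-integrable Omega (EFin \o (fun x => T (C - V x))).
Proof.
apply: (bounded_integrable mO Ofin (TV_measurable C) (K := alpha)) => x Ox.
by have /andP[? ?] := T_bd (C - V x); rewrite ger0_norm.
Qed.

Definition mass C := \int[mu]_(x in Omega) T (C - V x).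

Lemma L1norm_TV C : L1norm Omega (fun x => T (C - V x)) = mass C.
Proof.
apply: eq_Rintegral => x _.
by have /andP[? ?] := T_bd (C - V x); rewrite ger0_norm.
Qed.

Lemma mass_continuous : continuous mass.
Proof.
move=> C; have CI : C \in `]C - 1, C + 1[%classic by rewrite inE/= in_itv/=; lra.
apply: (@continuity_under_integral _ _ _ mu (fun C x => T (C - V x)) Omega mO
  (C - 1) (C + 1) _ _ (cst alpha) _ _ C CI).
- by move=> C' _; exact: TV_integrable.
- apply: aeW => x Ox C' _; apply: (@continuous_comp _ _ _ (fun C => C - V x) T).
    by apply: (@continuousB _ _ _ id (cst (V x))); [exact: cvg_id|exact: cst_continuous].
  exact: T_dU_inv_continuous.
- by apply: (bounded_integrable mO Ofin _ (K := alpha)) => // x _; rewrite ger0_norm// ltW.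
- move=> C' _; apply: aeW => x Ox.
  by have /andP[? ?] := T_bd (C' - V x); rewrite ger0_norm.
Qed.

Lemma volume_gt0 : 0 < volume Omega.
Proof. by rewrite /volume fine_gt0// open_lebesgue_gt0. Qed.

Lemma cst_integrable r : mu.-integrable Omega (EFin \o cst r).
Proof. by apply: (bounded_integrable mO Ofin _ (K := `|r|)) => //. Qed.

Lemma mass_le C r : (forall x, Omega x -> T (C - V x) <= r) ->
  mass C <= r * volume Omega.
Proof.
move=> h; rewrite -(Rintegral_cst _ mO); apply: le_Rintegral => //.
  exact: TV_integrable.
exact: cst_integrable.
Qed.

Lemma mass_ge C r : (forall x, Omega x -> r <= T (C - V x)) ->
  r * volume Omega <= mass C.
Proof.
move=> h; rewrite -(Rintegral_cst _ mO); apply: le_Rintegral => //.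
  exact: cst_integrable.
exact: TV_integrable.
Qed.

(** Half of the way from the mean density r = M / |Omega| to 0, respectively to
    alpha, gives levels whose masses lie on both sides of M. *)
Lemma mass_surjective : exists C, mass C = M.
Proof.
have v0 := volume_gt0; have /andP[M0 Ma] := M_bounds.
pose r := M / volume Omega.
have r0 : 0 < r by rewrite divr_gt0.
have ra : r < alpha by rewrite ltr_pdivrMr.
have rM : r * volume Omega = M by rewrite divfK// gt_eqF.
have K0 : 0 <= K.
  by have [x Ox] := O0; apply: le_trans (V_le Ox).
have I1 : 0 < r / 2 < alpha by lra.
have I2 : 0 < (r + alpha) / 2 < alpha by lra.
(* |V| <= K gives C - V <= U'(r / 2) at the level a, and the reverse at b *)
pose a := D (r / 2) - K; pose b := D ((r + alpha) / 2) + K.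
have ab : a <= b.
  suff : D (r / 2) <= D ((r + alpha) / 2) by rewrite /a /b; lra.
  by apply: D_le; rewrite ?in_itv//=; lra.
have ma : mass a <= M.
  apply: (@le_trans _ _ (r / 2 * volume Omega)).
    apply: mass_le => x Ox; rewrite leNgt T_dU_inv_gtE// -leNgt /a.
    by have := V_le Ox; rewrite ler_norml => /andP[]; lra.
  by rewrite -rM ler_pM2r//; lra.
have mb : M <= mass b.
  apply: (@le_trans _ _ ((r + alpha) / 2 * volume Omega)).
    by rewrite -rM ler_pM2r//; lra.
  apply: mass_ge => x Ox; rewrite leNgt T_dU_inv_ltE// -leNgt /b.
  by have := V_le Ox; rewrite ler_norml => /andP[]; lra.
have [||C _ CM] := @IVT R mass a b M ab; last by exists C.
  by apply: continuous_subspaceT; exact: mass_continuous.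
by rewrite ge_min le_max ma mb orbT.
Qed.

(** Where T(C1 - V) lies in (0, alpha), strict monotonicity of T makes
    T(C2 - V) - T(C1 - V) positive on a neighbourhood, that is on a set of positive
    measure; equal masses exclude this.  So T(C1 - V) maps the connected set Omega
    into {0, alpha}, and the mass bounds make both values occur. *)
Lemma mass_inj_lt C1 C2 : C1 < C2 -> mass C1 = M -> mass C2 = M -> False.
Proof.
move=> C12 m1 m2.
have ndeg x : Omega x -> T (C1 - V x) = 0 \/ T (C1 - V x) = alpha.
  move=> Ox; apply: contrapT => /not_orP[/eqP n0 /eqP na].
  have TI : 0 < T (C1 - V x) < alpha.
    by have /andP[h0 ha] := T_bd (C1 - V x); rewrite !lt_neqAle na ha eq_sym n0 h0.
  pose W := [set y | Omega y /\ 0 < T (C2 - V y) - T (C1 - V y)].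
  have oW : open W.
    rewrite openE => y [Oy Wy]; apply: filterI; first exact: open_nbhs_nbhs.
    have cT : {for y, continuous (fun y => T (C2 - V y) - T (C1 - V y))}.
      by apply: continuousB; apply: TV_continuous; rewrite inE.
    exact: (cvgr_gt _ cT _ Wy).
  have Wx : W x.
    split=> //; rewrite subr_gt0 lt_neqAle T_dU_inv_homo// ?andbT; last by lra.
    by apply/eqP => /(T_dU_inv_inj_interior alpha_gt0 D_le D_cont D_inj TI); lra.
  have : (0 < mu W)%E by apply: open_lebesgue_gt0 => //; exists x.
  suff -> : mu W = 0%E by rewrite ltxx.
  have mW : measurable W by exact: open_rV_measurable.
  apply/(negligibleP _ mW).
  pose f y := T (C2 - V y) - T (C1 - V y).
  have mf : measurable_fun Omega f.
    by apply: measurable_funB; exact: TV_measurable.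
  have f0 y : 0 <= f y by rewrite subr_ge0 T_dU_inv_homo//; lra.
  have if0 : \int[mu]_(y in Omega) f y = 0.
    by rewrite RintegralB ?TV_integrable// [X in X - _]m2 [X in _ - X]m1 subrr.
  have int_f : mu.-integrable Omega (EFin \o f).
    apply: (bounded_integrable mO Ofin mf (K := alpha)) => y Oy.
    rewrite ger0_norm// /f; have := T_bd (C1 - V y); have := T_bd (C2 - V y).
    by lra.
  have : (\int[mu]_(y in Omega) `|(EFin \o f) y| = 0)%E.
    rewrite (eq_integral (EFin \o f)); last first.
      by move=> y _; rewrite /= ger0_norm.
    rewrite -[LHS]fineK; last exact: integrable_fin_num.
    by rewrite -[X in X%:E]/(\int[mu]_(y in Omega) f y) if0.
  move/(ae_eq_integral_abs mu mO) => [|N [mN N0 fN]].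
    exact/measurable_EFinP.
  exists N; split=> // y [Oy fy]; apply: fN => /= /(_ Oy) [] fy0.
  by move: fy; rewrite -/(f y) fy0 ltxx.
have [x Ox x0] : exists2 x, Omega x & T (C1 - V x) = 0.
  apply: contrapT => /forall2NP h.
  have : alpha * volume Omega <= mass C1.
    apply: mass_ge => x Ox; have [h0|->//] := ndeg _ Ox.
    by have [] := h x.
  by rewrite m1 leNgt; have /andP[_ ->] := M_bounds.
have [y Oy ya] : exists2 y, Omega y & T (C1 - V y) = alpha.
  apply: contrapT => /forall2NP h.
  have : mass C1 <= 0 * volume Omega.
    apply: mass_le => y Oy; have [->//|ha] := ndeg _ Oy.
    by have [] := h y.
  by rewrite m1 mul0r leNgt; have /andP[-> _] := M_bounds.
have : connected ((fun x => T (C1 - V x)) @` Omega).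
  apply: connected_continuous_connected => //.
  by apply: continuous_in_subspaceT; exact: TV_continuous.
move/connected_intervalP => /(_ 0 alpha).
have z0 : [set T (C1 - V x) | x in Omega] 0 by exists x.
have za : [set T (C1 - V x) | x in Omega] alpha by exists y.
move=> /(_ z0 za (alpha / 2)) [|z Oz]; first by move: alpha_gt0 => ?; lra.
by have [->|->] := ndeg _ Oz; move: alpha_gt0 => ?; lra.
Qed.

Lemma mass_unique_level : exists! C, L1norm Omega (fun x => T (C - V x)) = M.
Proof.
have [C CM] := mass_surjective; exists C; split; first by rewrite L1norm_TV.
move=> C'; rewrite L1norm_TV => C'M; have [CC'|C'C|//] := ltgtP C C'.
  by have := mass_inj_lt CC' CM C'M.
by have := mass_inj_lt C'C C'M CM.
Qed.

End prescribed_mass.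

Theorem theorem2p6 (R : realType) (d : nat) (Omega : set 'rV[R]_d)
  (alpha s0 : R) (m U : R -> R) (V : 'rV[R]_d -> R)
  (d_gt0 : (0 < d)%N)
  (Omega_dom : bounded_smooth_domain Omega)
  (alpha_gt0 : 0 < alpha)
  (m_cont : {within `[0, alpha], continuous m})
  (m_C1 : Ck_line 1 `]0, alpha[ m)
  (m_0 : m 0 = 0) (m_alpha : m alpha = 0)
  (m_gt0 : forall s, 0 < s < alpha -> 0 < m s)
  (V_C2 : Ck_closure 2 Omega V)
  (V_ge0 : forall x, closure Omega x -> 0 <= V x)
  (* U is the continuous representative on [0, alpha]. *)
  (U_W11 : W11 `]0, alpha[ U)
  (U_cont : {within `[0, alpha], continuous U})
  (U_C3 : Ck_line 3 `]0, alpha[ U)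
  (U_convex : forall s, 0 < s < alpha -> 0 <= derive1n 2 U s)
  (s0_in : 0 < s0 < alpha)
  (U_s0 : 0 < derive1n 2 U s0)
  (mU_L1 : L1_on `]0, alpha[ (fun s => m s * derive1n 2 U s))
  (Phi_lt : forall s, 0 < s < alpha ->
    Phi m U s0 0 < Phi m U s0 s < Phi m U s0 alpha)
  (* Division in \bar R: r / 0 is infinite unless r = 0, and 0 / 0 = 0. *)
  (Phi_sup : (ereal_sup
    [set `| ((Phi m U s0 alpha - Phi m U s0 s) * Phi m U s0 s)%:E
              / (derive1 (Phi m U s0) s)%:E |
         + `| ((Phi m U s0 s - Phi m U s0 0) * Phi m U s0 s)%:E
              / (derive1 (Phi m U s0) s)%:E |
    | s in `]0%R, alpha[ ] < +oo)%E)
  (M : R) :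
  (forall rho : 'rV[R]_d -> R,
    L1_local_minimiser Omega (energy U V Omega) (calA_mass Omega alpha M) rho ->
    (M = 0 -> zeta_lo U <> -oo%E) ->
    (M = alpha * volume Omega -> zeta_hi U alpha <> +oo%E) ->
    exists C : R,
      [/\ {ae lebesgue_rV d, forall x, Omega x -> 0 <= rho x < alpha ->
            (C%:E <= dU U alpha (rho x) + (V x)%:E)%E},
          {ae lebesgue_rV d, forall x, Omega x -> 0 < rho x <= alpha ->
            (dU U alpha (rho x) + (V x)%:E <= C%:E)%E} &
          {in `]0, alpha[ &, injective (derive1 U)} ->
          {ae lebesgue_rV d, forall x, Omega x ->
            rho x = T_dU_inv U alpha (C - V x)}])
  /\
  ({ae lebesgue_measure, forall s : R, 0 < s < alpha -> 0 < derive1n 2 U s} ->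
   0 < M < alpha * volume Omega ->
   exists! C : R, L1norm Omega (fun x => T_dU_inv U alpha (C - V x)) = M).
Proof.
have [oO O0 cO bO _] := Omega_dom.
have [VCk Vclos _] := V_C2.
have [K V_le] := continuous_closure_bounded bO Vclos.
have V_cont : {in Omega, continuous V}.
  by move=> x /set_mem Ox; exact: (VCk.2 [::] x _ Ox).
have mO := open_rV_measurable oO.
have mV : measurable_fun Omega V by exact: continuous_open_measurable.
have Ofin := bounded_lebesgue_lty mO bO.
have inI s : 0 < s < alpha -> `]0, alpha[%classic s by rewrite /= in_itv.
have U_diff s : 0 < s < alpha -> derivable U s 1.
  by move=> /inI; exact: (U_C3.1 0%N).
have D_cont : {in `]0, alpha[%R, continuous (derive1 U)}.
  by move=> s; rewrite in_itv => /inI; exact: (U_C3.2 1%N).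
have D_le : {in `]0, alpha[%R &, {homo derive1 U : x y / x <= y}}.
  apply: ger0_derive1_le_oo.
  - by move=> s; rewrite in_itv => /inI; exact: (U_C3.1 1%N).
  - by move=> s; rewrite in_itv => /U_convex.
  - by move=> s /set_mem; exact: D_cont.
split=> [rho rho_min M0 Ma|Upos M_bounds].
  have [C [lC uC]] := pot_threshold alpha_gt0 D_le D_cont U_cont U_diff mO Ofin mV
    V_le rho_min M0 Ma.
  exists C; split=> // D_inj.
  have D_injR : {in `]0, alpha[%R &, injective (derive1 U)}.
    by move=> x y xI yI; apply: D_inj; rewrite inE.
  exact: (pot_minimiser_formula alpha_gt0 D_le rho_min lC uC D_injR).
have D_inj : {in `]0, alpha[%R &, injective (derive1 U)}.
  exact: ae_pos_derivative_inj.
exact: (mass_unique_level alpha_gt0 D_le D_cont D_inj oO O0 cO Ofin V_cont V_le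
  M_bounds).
Qed.
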